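(* Let $(A,\mathfrak m)$ be a Henselian Noetherian local ring. Then the homotopy category $\mathcal K^2(\operatorname{proj} A)$ of $2$-periodic complexes of finitely generated free $A$-modules is a Krull-Schmidt category.
   Context: A $2$-periodic complex is a cochain complex $X$ with $X^{n+2}=X^n$ and $\partial_{n+2}=\partial_n$ for all $n\in\mathbb Z$. A $2$-periodic map is a chain map $f$ with $f_{n+2}=f_n$ for all $n$. Two $2$-periodic maps $f,g\colon X\to Y$ are $2$-homotopic if there are maps $s_n\colon X^n\to Y^{n-1}$ with $s_{n+2}=s_n$ for all $n$ and $f-g=\partial_Y s+s\partial_X$. $\mathcal K^2(\operatorname{proj} A)$ has as objects the $2$-periodic complexes of finitely generated projective (equivalently free) $A$-modules and as morphisms the $2$-homotopy classes of $2$-periodic maps. An $A$-linear additive category is Krull-Schmidt if every object decomposes into a finite direct sum of objects having local endomorphism rings. *)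

(* Defs.v *)
From HB Require Import structures.
From mathcomp Require Import all_boot all_algebra.
From mathcomp Require Import boolp classical_sets.

Set Implicit Arguments.
Unset Strict Implicit.
Unset Printing Implicit Defensive.

Import GRing.Theory.

Local Open Scope ring_scope.
Local Open Scope classical_set_scope.
Local Open Scope quotient_scope.

Section Rings.

Definition left_ideal (R : pzRingType) (I : set R) : Prop :=
  [/\ I 0, forall x y, I x -> I y -> I (x + y)
    & forall a x, I x -> I (a * x)].

Definition maximal_left_ideal (R : pzRingType) (m : set R) : Prop :=
  [/\ left_ideal m, m <> setT
    & forall J, left_ideal J -> m `<=` J -> J <> setT -> J = m].

(* (R, m) is a local ring: m is the unique maximal left ideal of R.  R need not
   be commutative; when it is, left ideals are just ideals. *)
Definition local_ring_with (R : pzRingType) (m : set R) : Prop :=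
  maximal_left_ideal m /\ forall n, maximal_left_ideal n -> n = m.

Definition local_ring (R : pzRingType) : Prop :=
  exists m : set R, local_ring_with m.

Definition noetherian (A : comNzRingType) : Prop :=
  forall I : set A, left_ideal I ->
    exists (n : nat) (g : 'I_n -> A),
      I = [set x | exists c : 'I_n -> A, x = \sum_(i < n) c i * g i].

(* The images of p and q in (A/m)[X] are equal. *)
Definition eqpoly_mod (A : comNzRingType) (m : set A) (p q : {poly A}) : Prop :=
  forall i : nat, m (p - q)`_i.

(* The images of p and q in (A/m)[X] are coprime (m a maximal ideal). *)
Definition coprime_mod (A : comNzRingType) (m : set A) (p q : {poly A}) : Prop :=
  exists u v : {poly A}, eqpoly_mod m (u * p + v * q) 1.

(* Hensel's lemma holds for the local ring (A, m): if the image of a monic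
   F in (A/m)[X] is a product of two coprime monic polynomials, then these lift
   to monic polynomials over A with product F.  The polynomials over A/m are
   given through representatives g0, h0, which can always be chosen monic. *)
Definition henselian (A : comNzRingType) (m : set A) : Prop :=
  forall F g0 h0 : {poly A},
    F \is monic -> g0 \is monic -> h0 \is monic ->
    eqpoly_mod m F (g0 * h0) -> coprime_mod m g0 h0 ->
  exists g h : {poly A},
    [/\ g \is monic, h \is monic, F = g * h,
        eqpoly_mod m g g0 & eqpoly_mod m h h0].

End Rings.

Record linear_category (A : comNzRingType) := LinearCategory {
  ob :> Type;
  mor : ob -> ob -> lmodType A;
  mid : forall X, mor X X;
  mcomp : forall X Y Z, mor Y Z -> mor X Y -> mor X Z;
  mcompA : forall W X Y Z (h : mor Y Z) (g : mor X Y) (f : mor W X),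
    mcomp h (mcomp g f) = mcomp (mcomp h g) f;
  mcomp1m : forall X Y (f : mor X Y), mcomp (mid Y) f = f;
  mcompm1 : forall X Y (f : mor X Y), mcomp f (mid X) = f;
  mcomp_linearl : forall X Y Z (f : mor X Y) a (g g' : mor Y Z),
    mcomp (a *: g + g') f = a *: mcomp g f + mcomp g' f;
  mcomp_linearr : forall X Y Z (g : mor Y Z) a (f f' : mor X Y),
    mcomp g (a *: f + f') = a *: mcomp g f + mcomp g f'
}.

Arguments mor {A l} X Y.
Arguments mid {A l} X.
Arguments mcomp {A l X Y Z} g f.

Definition endo (A : comNzRingType) (C : linear_category A) (X : C) : Type :=
  mor X X.

Section EndoRing.
Variables (A : comNzRingType) (C : linear_category A) (X : C).

HB.instance Definition _ := GRing.Lmodule.on (endo X).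

Let mul (g f : endo X) : endo X := mcomp g f.

Fact endo_mulA : associative mul.
Proof. by move=> h g f; apply: mcompA. Qed.

Fact endo_mul1 : left_id (mid X : endo X) mul.
Proof. by move=> f; apply: mcomp1m. Qed.

Fact endo_mulr1 : right_id (mid X : endo X) mul.
Proof. by move=> f; apply: mcompm1. Qed.

Fact endo_mulDl : left_distributive mul +%R.
Proof.
by move=> g g' f; have := mcomp_linearl f 1 g g'; rewrite !scale1r.
Qed.

Fact endo_mulDr : right_distributive mul +%R.
Proof.
by move=> g f f'; have := mcomp_linearr g 1 f f'; rewrite !scale1r.
Qed.

HB.instance Definition _ := GRing.Zmodule_isPzRing.Build (endo X)
  endo_mulA endo_mul1 endo_mulr1 endo_mulDl endo_mulDr.

End EndoRing.

Section KrullSchmidt.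
Variables (A : comNzRingType) (C : linear_category A).

(* X is the biproduct of the Y i; for n = 0, X is a zero object. *)
Definition is_direct_sum (X : C) (n : nat) (Y : 'I_n -> C) : Prop :=
  exists (inj : forall i, mor (Y i) X) (prj : forall i, mor X (Y i)),
    [/\ forall i, mcomp (prj i) (inj i) = mid (Y i),
        forall i j, i != j -> mcomp (prj i) (inj j) = 0
      & \sum_(i < n) mcomp (inj i) (prj i) = mid X].

Definition additive_category : Prop :=
  forall (n : nat) (Y : 'I_n -> C), exists X : C, is_direct_sum X Y.

Definition krull_schmidt : Prop :=
  additive_category /\
  forall X : C, exists (n : nat) (Y : 'I_n -> C),
    is_direct_sum X Y /\ forall i, local_ring (endo (Y i)).

End KrullSchmidt.

(* A 2-periodic complex X of finitely generated free modules is determined by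
   ev = X^n for n even, od = X^n for n odd, and the two differentials; a
   vectType over A is precisely a finitely generated free A-module. *)
Record periodic_complex (A : comNzRingType) := PeriodicComplex {
  ev : vectType A;
  od : vectType A;
  dev : 'Hom(ev, od);
  dod : 'Hom(od, ev);
  dod_dev : (dod \o dev)%VF = 0;
  dev_dod : (dev \o dod)%VF = 0
}.

Section PeriodicMaps.
Variables (A : comNzRingType) (X Y : periodic_complex A).

Definition chain_map (f : 'Hom(ev X, ev Y) * 'Hom(od X, od Y)) : bool :=
  ((dev Y \o f.1)%VF == (f.2 \o dev X)%VF) &&
  ((dod Y \o f.2)%VF == (f.1 \o dod X)%VF).

Record periodic_map := PeriodicMap {
  pmap_val : 'Hom(ev X, ev Y) * 'Hom(od X, od Y);
  pmapP : chain_map pmap_val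
}.

Definition fev (f : periodic_map) := (pmap_val f).1.
Definition fod (f : periodic_map) := (pmap_val f).2.

HB.instance Definition _ := [isSub for pmap_val].
HB.instance Definition _ := [Choice of periodic_map by <:].

Fact chain_map_submod : submod_closed chain_map.
Proof.
split=> [|a f g]; rewrite !unfold_in /=.
  by rewrite !comp_lfun0l !comp_lfun0r !eqxx.
move=> /andP[/eqP f1 /eqP f2] /andP[/eqP g1 /eqP g2]; apply/andP; split.
  by rewrite /= comp_lfunDl comp_lfunDr -comp_lfunZr -comp_lfunZl f1 g1.
by rewrite /= comp_lfunDl comp_lfunDr -comp_lfunZr -comp_lfunZl f2 g2.
Qed.

HB.instance Definition _ := GRing.isSubmodClosed.Build A _ chain_map
  chain_map_submod.
HB.instance Definition _ := [SubChoice_isSubLmodule of periodic_map by <:].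

Definition homotopic (f g : periodic_map) : Prop :=
  exists (sev : 'Hom(ev X, od Y)) (sod : 'Hom(od X, ev Y)),
    fev f - fev g = (dod Y \o sev)%VF + (sod \o dev X)%VF /\
    fod f - fod g = (dev Y \o sod)%VF + (sev \o dod X)%VF.

Definition null_homotopic : {pred periodic_map} :=
  fun f => `[< homotopic f 0 >].

Fact null_homotopic_submod : submod_closed null_homotopic.
Proof.
split=> [|a f g]; rewrite !unfold_in.
  by apply/asboolP; exists 0, 0; rewrite !comp_lfun0l !comp_lfun0r !subrr !addr0.
move=> /asboolP[s [t [f1 f2]]] /asboolP[s' [t' [g1 g2]]]; apply/asboolP.
exists (a *: s + s'), (a *: t + t').
rewrite !comp_lfunDl !comp_lfunDr -!comp_lfunZr -!comp_lfunZl.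
rewrite /fev /fod /= !subr0 in f1 f2 g1 g2 *.
by rewrite f1 f2 g1 g2 !scalerDr !addrA; split; congr (_ + _); rewrite addrAC.
Qed.

HB.instance Definition _ := GRing.isSubmodClosed.Build A _ null_homotopic
  null_homotopic_submod.

(* The module of 2-homotopy classes of 2-periodic maps; see khom_eqP. *)
Definition khom : Type := Quotient.quot null_homotopic.

HB.instance Definition _ := GRing.Zmodule.on khom.
HB.instance Definition _ := EqQuotient.on khom.

Definition kclass (f : periodic_map) : khom := \pi f.

Lemma khom_eqP (f g : periodic_map) : kclass f = kclass g <-> homotopic f g.
Proof.
have h : (f - g \in null_homotopic) = (kclass f == kclass g).
  exact: Quotient.idealrBE.
rewrite unfold_in in h.
have E : homotopic (f - g) 0 = homotopic f g.
  by rewrite /homotopic /fev /fod /= !subr0.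
rewrite E in h.
by split=> [e | e]; [apply/asboolP; rewrite h e | apply/eqP; rewrite -h; apply/asboolP].
Qed.

Lemma kclass_repr (u : khom) : kclass (repr u) = u.
Proof. exact: reprK. Qed.

Lemma kclassD f g : kclass (f + g) = kclass f + kclass g.
Proof. exact: Quotient.pi_add. Qed.

Definition kscale (a : A) (u : khom) : khom := kclass (a *: repr u).

Lemma kscaleE a f : kscale a (kclass f) = kclass (a *: f).
Proof.
apply/khom_eqP.
have [s [t [e1 e2]]] : homotopic (repr (kclass f)) f.
  by apply/khom_eqP; rewrite kclass_repr.
exists (a *: s), (a *: t); rewrite /fev /fod /= in e1 e2 *.
by rewrite -!scalerBr e1 e2 !scalerDr -!comp_lfunZr -!comp_lfunZl.
Qed.

Fact kscaleA a b u : kscale a (kscale b u) = kscale (a * b) u.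
Proof. by rewrite -(kclass_repr u) !kscaleE scalerA. Qed.

Fact kscale1 : left_id 1 kscale.
Proof. by move=> u; rewrite -(kclass_repr u) kscaleE scale1r. Qed.

Fact kscaleDr : right_distributive kscale +%R.
Proof.
move=> a u v; rewrite -(kclass_repr u) -(kclass_repr v).
by rewrite -kclassD !kscaleE -kclassD scalerDr.
Qed.

Fact kscaleDl u : {morph kscale^~ u : a b / a + b}.
Proof.
by move=> a b; rewrite -(kclass_repr u) !kscaleE -kclassD scalerDl.
Qed.

HB.instance Definition _ := GRing.Zmodule_isLmodule.Build A khom
  kscaleA kscale1 kscaleDr kscaleDl.

Fact kclass_is_linear : linear kclass.
Proof. by move=> a f g; rewrite kclassD -kscaleE. Qed.

HB.instance Definition _ := GRing.isLinear.Build A periodic_map khom _ kclass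
  kclass_is_linear.

End PeriodicMaps.

Section HomotopyCategory.
Variable A : comNzRingType.
Implicit Types W X Y Z : periodic_complex A.

Fact pmap_id_chain X : chain_map ((\1%VF, \1%VF) : 'End(ev X) * 'End(od X)).
Proof. by rewrite /chain_map /= !comp_lfun1l !comp_lfun1r !eqxx. Qed.

Definition pmap_id X : periodic_map X X := PeriodicMap (pmap_id_chain X).

Fact pmap_comp_chain X Y Z (g : periodic_map Y Z) (f : periodic_map X Y) :
  chain_map ((fev g \o fev f)%VF, (fod g \o fod f)%VF).
Proof.
have /andP[/eqP gE /eqP gO] := pmapP g.
have /andP[/eqP fE /eqP fO] := pmapP f.
rewrite /chain_map /= /fev /fod.
by rewrite !comp_lfunA gE gO -!comp_lfunA fE fO !eqxx.
Qed.

Definition pmap_comp X Y Z (g : periodic_map Y Z) (f : periodic_map X Y) :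
  periodic_map X Z := PeriodicMap (pmap_comp_chain g f).

Lemma pmap_compA W X Y Z (h : periodic_map Y Z) (g : periodic_map X Y)
    (f : periodic_map W X) :
  pmap_comp h (pmap_comp g f) = pmap_comp (pmap_comp h g) f.
Proof. by apply: val_inj; rewrite /= /fev /fod /= !comp_lfunA. Qed.

Lemma pmap_comp1m X Y (f : periodic_map X Y) : pmap_comp (pmap_id Y) f = f.
Proof.
by apply: val_inj; rewrite /= /fev /fod /= !comp_lfun1l -surjective_pairing.
Qed.

Lemma pmap_compm1 X Y (f : periodic_map X Y) : pmap_comp f (pmap_id X) = f.
Proof.
by apply: val_inj; rewrite /= /fev /fod /= !comp_lfun1r -surjective_pairing.
Qed.

Lemma pmap_comp_linearl X Y Z (f : periodic_map X Y) a (g g' : periodic_map Y Z) :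
  pmap_comp (a *: g + g') f = a *: pmap_comp g f + pmap_comp g' f.
Proof.
by apply: val_inj; rewrite /= /fev /fod /= !comp_lfunDl -!comp_lfunZl.
Qed.

Lemma pmap_comp_linearr X Y Z (g : periodic_map Y Z) a (f f' : periodic_map X Y) :
  pmap_comp g (a *: f + f') = a *: pmap_comp g f + pmap_comp g f'.
Proof.
by apply: val_inj; rewrite /= /fev /fod /= !comp_lfunDr -!comp_lfunZr.
Qed.

Lemma pmap_comp_homotopic X Y Z (g g' : periodic_map Y Z)
    (f f' : periodic_map X Y) :
  homotopic g g' -> homotopic f f' ->
  homotopic (pmap_comp g f) (pmap_comp g' f').
Proof.
have /andP[/eqP gE /eqP gO] := pmapP g'.
have /andP[/eqP fE /eqP fO] := pmapP f.
rewrite -!/(fev _) -!/(fod _) in gE gO fE fO.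
move=> [s [t [sE tE]]] [s' [t' [sE' tE']]].
exists ((s \o fev f) + (fod g' \o s'))%VF, ((t \o fod f) + (fev g' \o t'))%VF.
have splitB (U V W : vectType A) (x x' : 'Hom(V, W)) (y y' : 'Hom(U, V)) :
    ((x \o y) - (x' \o y') = (x - x') \o y + (x' \o (y - y')))%VF.
  rewrite comp_lfunDl comp_lfunDr comp_lfunNl comp_lfunNr.
  by rewrite addrA subrK.
rewrite {1 2}/fev {1 2}/fod /= !splitB sE tE sE' tE' !comp_lfunDl !comp_lfunDr !comp_lfunA gE gO.
rewrite -!comp_lfunA fE fO; split.
- by rewrite !addrA; congr (_ + _); rewrite addrAC.
- by rewrite !addrA; congr (_ + _); rewrite addrAC.
Qed.

Definition kcomp X Y Z (v : khom Y Z) (u : khom X Y) : khom X Z :=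
  kclass (pmap_comp (repr v) (repr u)).

Lemma kcompE X Y Z (g : periodic_map Y Z) (f : periodic_map X Y) :
  kcomp (kclass g) (kclass f) = kclass (pmap_comp g f).
Proof.
by apply/khom_eqP; apply: pmap_comp_homotopic; apply/khom_eqP;
  rewrite kclass_repr.
Qed.

Fact kcompA W X Y Z (w : khom Y Z) (v : khom X Y) (u : khom W X) :
  kcomp w (kcomp v u) = kcomp (kcomp w v) u.
Proof.
rewrite -(kclass_repr u) -(kclass_repr v) -(kclass_repr w).
by rewrite !kcompE pmap_compA.
Qed.

Fact kcomp1m X Y (u : khom X Y) : kcomp (kclass (pmap_id Y)) u = u.
Proof. by rewrite -(kclass_repr u) kcompE pmap_comp1m. Qed.

Fact kcompm1 X Y (u : khom X Y) : kcomp u (kclass (pmap_id X)) = u.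
Proof. by rewrite -(kclass_repr u) kcompE pmap_compm1. Qed.

Fact kcomp_linearl X Y Z (u : khom X Y) a (v v' : khom Y Z) :
  kcomp (a *: v + v') u = a *: kcomp v u + kcomp v' u.
Proof.
rewrite -(kclass_repr u) -(kclass_repr v) -(kclass_repr v').
by rewrite -linearP !kcompE pmap_comp_linearl linearP.
Qed.

Fact kcomp_linearr X Y Z (v : khom Y Z) a (u u' : khom X Y) :
  kcomp v (a *: u + u') = a *: kcomp v u + kcomp v u'.
Proof.
rewrite -(kclass_repr u) -(kclass_repr v) -(kclass_repr u').
by rewrite -linearP !kcompE pmap_comp_linearr linearP.
Qed.

End HomotopyCategory.

Definition K2proj (A : comNzRingType) : linear_category A :=
  @LinearCategory A (periodic_complex A) (fun X Y => khom X Y : lmodType A)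
    (fun X => kclass (pmap_id X)) (@kcomp A)
    (@kcompA A) (@kcomp1m A) (@kcompm1 A) (@kcomp_linearl A) (@kcomp_linearr A).

(* Main.v *)
(* Over a Henselian local ring, the 2-periodic complexes already form a
   Krull-Schmidt category before passing to homotopy classes.  An endomorphism f
   of X is killed by its characteristic polynomial F.  Modulo m, F is X^a h0 with
   h0(0) <> 0; lift this factorization to F = g h.  By Bezout modulo m, a
   combination u g + v h becomes invertible at f (its determinant is a unit), and
   normalizing v h by its inverse gives an idempotent e of the commutative algebra
   A[f].  If e = 0 then h(f) = 0 with h(0) a unit, so f is invertible; if e = 1
   then g(f) = 0 with g(1) a unit, so f - 1 is invertible.  Hence X has a local
   endomorphism ring as soon as it has no nontrivial idempotent chain
   endomorphism.  Nontrivial idempotents split because finitely generated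
   projective modules over A are free, and this lowers the total rank.  Passing
   to the homotopy category, endomorphism rings become quotients of the previous
   ones, hence stay local unless the summand is contractible. *)

Require Import Defs.
From mathcomp Require Import all_boot all_algebra.
From mathcomp Require Import boolp classical_sets.

Set Implicit Arguments.
Unset Strict Implicit.
Unset Printing Implicit Defensive.

Import GRing.Theory VectorInternalTheory.

Local Open Scope ring_scope.
Local Open Scope classical_set_scope.

(** * Maximal left ideals and a criterion for a possibly noncommutative ring to be local *)

Section LeftIdeals.
Variable R : pzRingType.
Implicit Types (I J : set R) (x y : R).

Lemma left_idealB I x y : left_ideal I -> I x -> I y -> I (x - y).
Proof. by move=> [_ ID IM] Ix Iy; rewrite -mulN1r; apply/ID/IM. Qed.

Lemma left_ideal_properP I : left_ideal I -> (I <> setT <-> ~ I 1).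
Proof.
move=> [_ _ IM]; split=> [IT I1|I1 IT]; last by apply: I1; rewrite IT.
by apply: IT; rewrite -subTset => x _; rewrite -[x]mulr1; apply: IM.
Qed.

Lemma exists_maximal_left_ideal I : left_ideal I -> I <> setT ->
  exists2 J, maximal_left_ideal J & I `<=` J.
Proof.
move=> idI /(left_ideal_properP idI) I1.
(* The empty set is admitted because [Zorn_bigcup] also bounds the empty
   chain. *)
pose P J := J = set0 \/ [/\ left_ideal J, ~ J 1 & I `<=` J].
have [F FP Ftot|J [PJ Jmax]] := @Zorn_bigcup R P.
  have [[K FK [x Kx]]|F0] := pselect (exists2 K, F K & K !=set0); last first.
    left; rewrite -subset0 => x [K FK Kx].
    by apply: F0; exists K => //; exists x.
  have FI L y : F L -> L y -> [/\ left_ideal L, ~ L 1 & I `<=` L].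
    by move=> /FP[->|//].
  have [idK K1 IK] := FI _ _ FK Kx.
  right; split=> [|[L FL L1]|y Iy]; last by exists K => //; apply: IK.
  - split=> [|y z [L FL Ly] [L' FL' L'z]|a y [L FL Ly]].
    + by exists K => //; case: idK.
    + have [LL'|L'L] := Ftot _ _ FL FL'.
        exists L' => //; have [[_ LD _] _ _] := FI _ _ FL' L'z.
        by apply: LD => //; apply: LL'.
      exists L => //; have [[_ LD _] _ _] := FI _ _ FL Ly.
      by apply: LD => //; apply: L'L.
    + by exists L => //; have [[_ _ LM] _ _] := FI _ _ FL Ly; apply: LM.
  - by have [_ + _] := FI _ _ FL L1.
case: PJ => [J0|[idJ J1 IJ]].
  exfalso; apply: (Jmax I); last by right; split=> //; apply/left_ideal_properP.
  rewrite J0; split; first exact: sub0set.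
  by move=> /(_ 0); apply; case: idI.
exists J => //; split=> // [|K idK JK /(left_ideal_properP idK) K1].
  exact/left_ideal_properP.
apply: contrapT => KJ; apply: (Jmax K); last first.
  by right; split=> //; apply: subset_trans JK.
by split=> // KsubJ; apply: KJ; rewrite eqEsubset.
Qed.

(** Otherwise the left ideal [R x] is proper, and the maximal left ideal containing it is [m]. *)
Lemma local_ring_linv (m : set R) x :
  local_ring_with m -> ~ m x -> exists y, y * x = 1.
Proof.
move=> [_ muniq] mx; apply: contrapT => xinv.
pose I := [set z | exists y, z = y * x].
have idI : left_ideal I.
  split=> [|_ _ [y ->] [z ->]|a _ [y ->]]; first by exists 0; rewrite mul0r.
  - by exists (y + z); rewrite mulrDl.
  - by exists (a * y); rewrite mulrA.
have /(left_ideal_properP idI) Iproper : ~ I 1.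
  by move=> [y /esym xy]; apply: xinv; exists y.
have [J /muniq -> Im] := exists_maximal_left_ideal idI Iproper.
by apply: mx; apply: Im; exists 1; rewrite mul1r.
Qed.

(** The elements without a left inverse form a left ideal [N], which contains every proper left
    ideal. *)
Lemma local_ring_criterion : (1 : R) <> 0 ->
  (forall x, (exists y, y * x = 1) \/ (exists y, y * (1 - x) = 1)) ->
  local_ring R.
Proof.
move=> nz1 linvP; pose N := [set x : R | ~ exists y, y * x = 1].
have idN : left_ideal N.
  split=> [[y]|x y Nx Ny [z zxy]|a x Nx [y yax]].
  - by rewrite mulr0 => /esym.
  (* If [z * (x + y) = 1], the hypothesis at [z * x] left-inverts [x] or [y]. *)
  - have zx : z * y = 1 - z * x by rewrite -zxy mulrDr addrAC subrr add0r.
    case: (linvP (z * x)) => -[t].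
      by rewrite mulrA => tzx; apply: Nx; exists (t * z).
    by rewrite -zx mulrA => tzx; apply: Ny; exists (t * z).
  - by apply: Nx; exists (y * a); rewrite -mulrA.
have subN J : left_ideal J -> J <> setT -> J `<=` N.
  move=> idJ /(left_ideal_properP idJ) J1 x Jx [y yx]; apply: J1.
  by rewrite -yx; case: idJ => _ _; apply.
have Nproper : N <> setT.
  by apply/left_ideal_properP => // N1; apply: N1; exists 1; rewrite mulr1.
exists N; split; first split=> // J idJ NJ Jproper.
  by rewrite eqEsubset; split=> //; apply: subN.
move=> J [idJ Jproper Jmax]; apply/esym/Jmax => //; exact: subN.
Qed.

End LeftIdeals.

(** * Matrices and polynomials modulo the maximal ideal *)

Section LocalRing.
Variables (A : comNzRingType) (m : set A).
Hypothesis hm : local_ring_with m.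

Let idm : left_ideal m. Proof. by case: hm => -[]. Qed.
Let mD x y : m x -> m y -> m (x + y). Proof. by case: idm => _ + _; apply. Qed.
Let mM a x : m x -> m (a * x). Proof. by case: idm => _ _; apply. Qed.
Let mB x y : m x -> m y -> m (x - y). Proof. exact: left_idealB. Qed.
Let m0 : m 0. Proof. by case: idm. Qed.
Let m1 : ~ m 1. Proof. by apply/left_ideal_properP => //; case: hm => -[]. Qed.

Lemma maximal_sum (I : Type) (r : seq I) (P : pred I) (F : I -> A) :
  (forall i, P i -> m (F i)) -> m (\sum_(i <- r | P i) F i).
Proof. by move=> mF; apply: big_ind. Qed.

Lemma maximal_inv x y : m (x - y) -> ~ m y -> exists z, z * x = 1.
Proof.
move=> mxy my; apply: (local_ring_linv hm) => mx.
by apply: my; rewrite -[y](subKr x); apply: mB.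
Qed.

Lemma maximal_det n (M N : 'M[A]_n) :
  (forall i j, m (M i j - N i j)) -> m (\det M - \det N).
Proof.
move=> MN; have mMl x y a : m (x - y) -> m (a * x - a * y).
  by rewrite -mulrBr; apply: mM.
rewrite /determinant; apply: (big_ind2 (fun x y => m (x - y))) => [||s _].
- by rewrite subrr.
- by move=> x y x' y' xy xy'; rewrite opprD addrACA; apply: mD.
apply: mMl; apply: (big_ind2 (fun x y => m (x - y))) => //.
  by rewrite subrr.
move=> x y x' y' xy xy'.
rewrite -[X in m X](subrKA (y * x')) -mulrBl mulrC -mulrBr.
by apply: mD; apply: mM.
Qed.

(** The determinant is congruent to 1, hence a unit, and the adjugate yields the inverse. *)
Lemma mx_inv_mod n (M : 'M[A]_n) :
  (forall i j, m (M i j - 1%:M i j)) ->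
  exists N, N *m M = 1%:M /\ M *m N = 1%:M.
Proof.
move=> /maximal_det; rewrite det1 => /maximal_inv/(_ m1)[z zM].
have NM : (z *: \adj M) *m M = 1%:M.
  by rewrite -scalemxAl mul_adj_mx scale_scalar_mx zM.
by exists (z *: \adj M); split=> //; apply: mulmx1C.
Qed.

(** [1%:M - E] is invertible and annihilates [E]. *)
Lemma idempotent_mod_eq0 n (E : 'M[A]_n) :
  E *m E = E -> (forall i j, m (E i j)) -> E = 0.
Proof.
move=> EE mE; have [|N [NM _]] := @mx_inv_mod n (1%:M - E).
  by move=> i j; rewrite !mxE addrAC subrr; apply: mB.
rewrite -[E]mul1mx -NM -mulmxA mulmxBl mul1mx EE subrr.
exact: mulmx0.
Qed.

(** This is the freeness of finitely generated projective modules over [A]: the image of [E] becomes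
    free of rank [r]. *)
Lemma split_idempotent_mx n (E : 'M[A]_n) : E *m E = E ->
  exists r (P : 'M_(n, r)) (Q : 'M_(r, n)),
    [/\ r <= n, Q *m P = 1%:M, P *m Q = E & E != 1%:M -> r < n]%N.
Proof.
move=> EE.
(* [S r] says that the image of [E] has a free summand of rank [r]; a largest such [r] exists, as
   [n] is a bound. *)
pose S r := `[< exists (P : 'M[A]_(n, r)) (Q : 'M_(r, n)),
  [/\ Q *m P = 1%:M, E *m P = P & Q *m E = Q] >].
have S0 : exists r, S r.
  exists 0; apply/asboolP; exists 0, 0.
  by rewrite !mulmx0 mul0mx; split=> //; apply/matrixP; case.
have Sle r : S r -> (r <= n)%N.
  by move=> /asboolP[P [Q [/mulmx1_min]]].
have [r /asboolP[P [Q [QP EP QE]]] rmax] := ex_maxnP S0 Sle.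
have le_rn := mulmx1_min QP; exists r, P, Q.
suff PQ : P *m Q = E.
  split=> // E1; rewrite ltn_neqAle le_rn andbT; apply: contraNneq E1 => rn.
  by subst r; rewrite -PQ; apply/eqP/mulmx1C.
(* [F] projects onto the rest of the image; an entry of [F] outside [m] would contradict the
   maximality of [r]. *)
pose F := E - P *m Q.
have FF : F *m F = F.
  rewrite mulmxBl !mulmxBr EE !mulmxA EP -!mulmxA QE [Q *m (P *m Q)]mulmxA QP
    mul1mx.
  by rewrite subrr subr0.
apply/esym/eqP; rewrite -subr_eq0 -/F; apply/eqP.
apply: idempotent_mod_eq0 => // i j; apply: contrapT => mF.
have [c cF] := local_ring_linv hm mF.
suff /rmax : S (1 + r)%N by rewrite ltnn.
have QF : Q *m F = 0 by rewrite mulmxBr QE mulmxA QP mul1mx subrr.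
have FP : F *m P = 0 by rewrite mulmxBl EP -mulmxA QP mulmx1 subrr.
have EF : E *m F = F by rewrite mulmxBr EE mulmxA EP.
have FE : F *m E = F by rewrite mulmxBl EE -mulmxA QE.
(* A unit entry of the idempotent F splits off one more free summand: column j
   and the rescaled row i of F. *)
apply/asboolP; exists (row_mx (col j F) P), (col_mx (c *: row i F) Q).
rewrite colE rowE; split.
- rewrite mul_col_row -!scalemxAl QP -(mulmxA _ F P) FP mulmx0 scaler0.
  rewrite (mulmxA Q) QF mul0mx !mulmxA -(mulmxA _ F F) FF.
  rewrite -rowE -colE.
  rewrite [X in block_mx X](_ : _ = 1%:M) -?scalar_mx_block //.
  by apply/matrixP=> a b; rewrite !ord1 [RHS]mxE eqxx -cF [LHS]mxE [in LHS]mxE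
    mxE.
- by rewrite mul_mx_row mulmxA EF EP.
- by rewrite mul_col_mx -scalemxAl -mulmxA FE QE.
Qed.

Lemma horner_mod (p q : {poly A}) a : eqpoly_mod m p q -> m (p.[a] - q.[a]).
Proof.
move=> pq; rewrite -hornerN -hornerD horner_coef.
by apply: maximal_sum => i _; rewrite mulrC; apply: mM.
Qed.

Lemma horner_mx_mod n (M : 'M[A]_n.+1) (p q : {poly A}) : eqpoly_mod m p q ->
  forall i j, m (horner_mx M p i j - horner_mx M q i j).
Proof.
move=> pq i j; have -> : horner_mx M p i j - horner_mx M q i j = horner_mx M
  (p - q) i j.
  by rewrite rmorphB !mxE.
rewrite -[p - q]coefK poly_def rmorph_sum summxE; apply: maximal_sum => k _ /=.
by rewrite linearZ mxE mulrC; apply: mM.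
Qed.

(** Modulo multiples of ['X - a%:P], [p] is the constant [p.[a]]; evaluating at [M] makes this unit
    a multiple of [M - a%:M]. *)
Lemma horner_mx_inv n (M : 'M[A]_n.+1) (p : {poly A}) (a y : A) :
  horner_mx M p = 0 -> y * p.[a] = 1 ->
  exists q, horner_mx M q *m (M - a%:M) = 1%:M.
Proof.
move=> pM ya; have /factor_theorem[q pq] : root (p - p.[a]%:P) a.
  by rewrite /root !hornerE subrr.
exists (- y *: q).
have -> : M - a%:M = horner_mx M ('X - a%:P) by rewrite rmorphB /= horner_mx_X
  horner_mx_C.
rewrite mulmxE -rmorphM /= -scalerAl -pq linearZ rmorphB /= pM sub0r
  horner_mx_C.
by rewrite scaleNr scalerN opprK scale_scalar_mx ya.
Qed.

Lemma monic_mod_factor (p : {poly A}) : p \is monic ->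
  exists a h c, [/\ h \is monic, eqpoly_mod m p ('X^a * h),
                    coprime_mod m 'X^a h & c * h.[0] = 1].
Proof.
move=> pmon; have ex : exists i, ~~ `[< m p`_i >].
  by exists (size p).-1; rewrite -lead_coefE (monicP pmon); apply/asboolPn.
(* [a] is the order of vanishing at 0 of [p] modulo [m]; removing the terms below degree [a] and
   dividing by ['X^a] gives [h]. *)
have [a /asboolPn ma amin] := ex_minnP ex.
have lta : (a < size p)%N.
  by rewrite ltnNge; apply/negP => /leq_sizeP/(_ a (leqnn _)) pa; apply: ma;
    rewrite pa.
have [c ca] := local_ring_linv hm ma.
pose h := drop_poly a p; exists a, h, c.
have h0 : h.[0] = p`_a by rewrite horner_coef0 coef_drop_poly.
split; last by rewrite h0.
- apply/monicP; rewrite lead_coefE size_drop_poly coef_drop_poly.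
  rewrite -(monicP pmon) lead_coefE; congr (p`_ _); apply: succn_inj.
  by rewrite -addSn !prednK ?subn_gt0 ?subnK ?(ltnW lta) // (leq_trans _ lta).
- move=> i; rewrite -{1}(poly_take_drop a p) mulrC addrK coef_take_poly.
  case: ltnP => // ia; apply: contrapT => /asboolPn/amin.
  by rewrite leqNgt ia.
have /factor_theorem[q] : root (h - h.[0]%:P) 0 by rewrite /root !hornerE subrr.
rewrite subr0 => hq.
(* With [y := c h], [1 - y] is a multiple of X, so [(1 - y)^a] is a multiple of
   X^a while [1 - (1 - y)^a] is a multiple of [h]. *)
exists ((- c *: q) ^+ a), (c *: \sum_(i < a) (1 - c *: h) ^+ i) => i.
suff -> : (- c *: q) ^+ a * 'X^a + (c *: \sum_(i < a) (1 - c *: h) ^+ i) * h =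
  1.
  by rewrite subrr coef0.
have -> : (- c *: q) ^+ a * 'X^a = (1 - c *: h) ^+ a.
  rewrite -exprMn -scalerAl -hq; congr (_ ^+ a).
  by rewrite scaleNr scalerBr -[c *: _%:P]mul_polyC -polyCM h0 ca opprB.
rewrite -scalerAl mulrC scalerAl; set t := 1 - c *: h.
have -> : c *: h = - (t - 1) by rewrite opprB subKr.
by rewrite mulNr -subrX1 opprB addrC subrK.
Qed.

(* The bicommutant stands in for the subalgebra A[M]: membership in it is
   obviously inherited by inverses, and it is all that is needed to move from
   matrices back to chain maps. *)
Definition bicomm_mx n (M k : 'M[A]_n) := forall B, comm_mx M B -> comm_mx k B.

Lemma linv_comm_mx n (N K B : 'M[A]_n) :
  N *m K = 1%:M -> comm_mx K B -> comm_mx N B.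
Proof.
move=> NK KB; rewrite /comm_mx -[in LHS](mulmx1 B) -(mulmx1C NK) [B *m _]mulmxA.
by rewrite -KB !mulmxA NK mul1mx.
Qed.

(** The idempotent constructed projects onto the part where [M] is nilpotent modulo [m]; on the
    complement [M] is invertible. *)
Lemma fitting_mx n (M : 'M[A]_n) : henselian m ->
  exists e : 'M_n, [/\ bicomm_mx M e, e *m e = e,
    e = 0 -> exists2 N, bicomm_mx M N & N *m M = 1%:M &
    e = 1%:M -> exists2 N, bicomm_mx M N & N *m (M - 1%:M) = 1%:M].
Proof.
(* [horner_mx] requires a nonzero size; all 0 by 0 matrices are equal. *)
case: n M => [|n] M hens.
  have flat (B C : 'M[A]_0) : B = C by apply/matrixP; case.
  by exists 0; split=> // *; do ?exists 0.
have [a [h0 [c [h0mon Mh0 cop ch0]]]] := monic_mod_factor (char_poly_monic M).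
have [g [h [gmon hmon Mgh gX hh0]]] :=
  hens _ _ _ (char_poly_monic M) (monicXn _ a) h0mon Mh0 cop.
have [u [v uv]] := cop.
pose ev := horner_mx M.
have evM p q : ev (p * q) = ev p *m ev q by apply: rmorphM.
have evB p : bicomm_mx M (ev p) by move=> B; apply: comm_horner_mx.
have GH : ev (g * h) = 0 by rewrite -Mgh; apply: Cayley_Hamilton.
(* The Bezout relation of ['X^a] and [h0] survives modulo [m] for the congruent lifts [g] and
   [h]. *)
have coprime_gh : eqpoly_mod m (u * g + v * h) 1.
  move=> i; have -> : u * g + v * h - 1
      = u * (g - 'X^a) + (v * (h - h0) + (u * 'X^a + v * h0 - 1)).
    by rewrite addrA [RHS]addrA addrACA -!mulrDr !subrK.
  rewrite 2!coefD; apply: mD; last apply: mD; last exact: uv.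
    by rewrite coefM; apply: maximal_sum => k _; apply/mM/gX.
  by rewrite coefM; apply: maximal_sum => k _; apply/mM/hh0.
have [|K [K1 K2]] := @mx_inv_mod _ (ev (u * g + v * h)).
  by move=> i j; rewrite -[1%:M](horner_mx_C M); apply: horner_mx_mod.
have KB : bicomm_mx M K by move=> B /(evB (u * g + v * h)); apply: linv_comm_mx.
have KevC p : ev p *m K = K *m ev p by
  apply/esym/KB/comm_mx_horner/comm_mx_refl.
have ev0 p : ev (p * (g * h)) = 0. by rewrite evM GH mulmx0.
(* Normalized by [K], the two Bezout terms add up to 1; their product contains the factor
   [ev (g * h) = 0]. *)
pose x := K *m ev (u * g); pose y := K *m ev (v * h).
have xy : x + y = 1%:M by rewrite -mulmxDr -rmorphD.
have xy0 : x *m y = 0.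
  rewrite /x /y mulmxA -[K *m _ *m K]mulmxA KevC -!mulmxA -evM.
  by rewrite mulrACA ev0 !mulmx0.
exists y; split.
- by move=> B MB; apply/comm_mx_sym/comm_mxM; apply: comm_mx_sym;
  [apply: KB | apply: evB].
- by rewrite -[y in RHS]mul1mx -xy mulmxDl xy0 add0r.
- move=> y0.
  have evh : ev h = 0.
    rewrite -[ev h]mulmx1 -xy y0 addr0 /x mulmxA KevC -mulmxA -evM.
    by rewrite mulrC -mulrA ev0 mulmx0.
  have [] : exists z, z * h.[0] = 1.
    apply: (maximal_inv (horner_mod 0 hh0)) => mh0; apply: m1.
    by rewrite -ch0; apply: mM.
  move=> z /(horner_mx_inv evh)[q]; rewrite raddf0 subr0.
  by exists (ev q).
- move=> y1.
  have evg : ev g = 0.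
    rewrite -[ev g]mulmx1 -y1 /y mulmxA KevC -mulmxA -evM.
    by rewrite mulrCA ev0 mulmx0.
  (* [g] is congruent to ['X^a], whose value at 1 is 1. *)
  have [] : exists z, z * g.[1] = 1.
    apply: (maximal_inv (horner_mod 1 gX)).
    by rewrite hornerXn expr1n.
  move=> z /(horner_mx_inv evg)[q].
  by exists (ev q).
Qed.

End LocalRing.

(** * Linear maps between free modules as matrices *)

Section MatrixOfLfun.
Variable A : comNzRingType.
Implicit Types U V W : vectType A.

Lemma lfun_mxE U V (f : 'Hom(U, V)) u : f u = r2v (v2r u *m f2mx f).
Proof. by rewrite unlock. Qed.

Lemma f2mxP U V (f : 'Hom(U, V)) (M : 'M_(dim U, dim V)) :
  (forall u, f u = r2v (v2r u *m M)) -> f2mx f = M.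
Proof.
by move=> fM; rewrite (_ : f = Hom M) //; apply/lfunP=> u; rewrite fM lfun_mxE.
Qed.

Lemma f2mx_comp U V W (g : 'Hom(V, W)) (f : 'Hom(U, V)) :
  f2mx (g \o f)%VF = f2mx f *m f2mx g.
Proof. by apply: f2mxP => u; rewrite comp_lfunE !lfun_mxE r2vK mulmxA. Qed.

Lemma f2mx_id V : f2mx (\1%VF : 'End(V)) = 1%:M.
Proof. by apply: f2mxP => u; rewrite id_lfunE mulmx1 v2rK. Qed.

Lemma f2mx0 U V : f2mx (0 : 'Hom(U, V)) = 0.
Proof. by apply: f2mxP => u; rewrite zero_lfunE mulmx0 linear0. Qed.

Lemma f2mxB U V (f g : 'Hom(U, V)) : f2mx (f - g) = f2mx f - f2mx g.
Proof.
by apply: f2mxP => u; rewrite add_lfunE opp_lfunE !lfun_mxE mulmxBr linearB.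
Qed.

Lemma split_idempotent_lfun (m : set A) V (e : 'End(V)) :
  local_ring_with m -> (e \o e)%VF = e ->
  exists W (i : 'Hom(W, V)) (p : 'Hom(V, W)),
    [/\ dim W <= dim V, (p \o i)%VF = \1%VF, (i \o p)%VF = e
      & e <> \1%VF -> dim W < dim V]%N.
Proof.
move=> hm ee; have EE : f2mx e *m f2mx e = f2mx e by rewrite -f2mx_comp ee.
have [r [P [Q [le_r QP PQ lt_r]]]] := split_idempotent_mx hm EE.
(* Matrices act on row vectors from the right, so [Q] gives the inclusion and [P] the projection. *)
pose i : 'Hom('rV[A]_r, V) := linfun (r2v \o mulmxr Q).
pose p : 'Hom(V, 'rV[A]_r) := linfun (mulmxr P \o v2r).
have dimr : dim 'rV[A]_r = r by rewrite /dim /= mul1n.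
exists 'rV[A]_r, i, p; rewrite dimr; split=> //.
- by apply/lfunP=> u; rewrite comp_lfunE !lfunE /= r2vK -mulmxA QP mulmx1.
- by apply/lfunP=> u; rewrite comp_lfunE !lfunE /= -mulmxA PQ lfun_mxE.
- move=> e1; apply: lt_r; apply: contra_not_neq e1 => E1.
  by apply: val_inj; rewrite /= f2mx_id.
Qed.
End MatrixOfLfun.

(** * Fitting idempotents among the chain endomorphisms of a complex *)

Section Fitting.
Variables (A : comNzRingType) (m : set A) (X : periodic_complex A).
Hypotheses (hm : local_ring_with m) (hens : henselian m).

Local Notation size_mx := (dim (ev X) + dim (od X))%N.

(** Both degrees enter one matrix, so that a single characteristic polynomial serves the whole
    complex. *)
Definition mx_of_pmap (f : periodic_map X X) : 'M[A]_size_mx :=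
  block_mx (f2mx (fev f)) 0 0 (f2mx (fod f)).

Let D : 'M[A]_size_mx :=
  block_mx 0 (f2mx (dev X)) (f2mx (dod X)) 0.
(* Commuting with [parity] means being block diagonal. *)
Let parity : 'M[A]_size_mx := block_mx 1%:M 0 0 0.

Lemma mx_of_pmap_comm f : comm_mx (mx_of_pmap f) D /\ comm_mx (mx_of_pmap f)
  parity.
Proof.
have /andP[/eqP f1 /eqP f2] := pmapP f.
rewrite /comm_mx !mulmx_block; split; last first.
  by rewrite !(mulmx0, mul0mx, mulmx1, mul1mx, addr0, add0r).
by rewrite !(mulmx0, mul0mx, addr0, add0r) -!f2mx_comp f1 f2.
Qed.

(** Commuting with [parity] kills the off-diagonal blocks; commuting with the total differential [D]
    then makes the diagonal blocks a chain map. *)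
Lemma pmap_of_mx (M : 'M[A]_size_mx) :
  comm_mx M D -> comm_mx M parity -> exists f, mx_of_pmap f = M.
Proof.
rewrite -[M]submxK; move: (ulsubmx M) (ursubmx M) (dlsubmx M) (drsubmx M).
move=> M1 M2 M3 M4 MD MP.
have /eq_block_mx[_ e2 e3 _] := etrans (esym (mulmx_block _ _ _ _ _ _ _ _))
  (etrans MP (mulmx_block _ _ _ _ _ _ _ _)).
move: e2 e3; rewrite !(mulmx0, mul0mx, mulmx1, mul1mx, addr0, add0r) => M20 M30.
subst.
have /eq_block_mx[_ e2 e3 _] := etrans (esym (mulmx_block _ _ _ _ _ _ _ _))
  (etrans MD (mulmx_block _ _ _ _ _ _ _ _)).
move: e2 e3; rewrite !(mulmx0, mul0mx, addr0, add0r) => e2 e3.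
have fP : chain_map ((Hom M1, Hom M4) : 'End(ev X) * 'End(od X)).
  by apply/andP; split; apply/eqP/val_inj; rewrite /= !f2mx_comp.
by exists (PeriodicMap fP).
Qed.

Lemma mx_of_pmap_comp f g : mx_of_pmap (pmap_comp g f) = mx_of_pmap f *m
  mx_of_pmap g.
Proof.
rewrite /mx_of_pmap /fev /fod /= !f2mx_comp mulmx_block.
by rewrite !(mulmx0, mul0mx, addr0, add0r).
Qed.

Lemma mx_of_pmap_id : mx_of_pmap (pmap_id X) = 1%:M.
Proof. by rewrite /mx_of_pmap /fev /fod /= !f2mx_id -scalar_mx_block. Qed.

Lemma mx_of_pmap0 : mx_of_pmap 0 = 0.
Proof. by rewrite /mx_of_pmap /fev /fod /= !f2mx0 block_mx0. Qed.

Lemma mx_of_pmapB f g : mx_of_pmap (f - g) = mx_of_pmap f - mx_of_pmap g.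
Proof.
by rewrite /mx_of_pmap /fev /fod /= !f2mxB opp_block_mx add_block_mx !subr0.
Qed.

Lemma mx_of_pmap_inj : injective mx_of_pmap.
Proof.
move=> f g /eq_block_mx[/val_inj e1 _ _ /val_inj e2].
by apply: val_inj; rewrite [LHS]surjective_pairing [RHS]surjective_pairing;
  congr (_, _).
Qed.

Lemma fitting_pmap (f : periodic_map X X) :
  exists e : periodic_map X X, [/\ pmap_comp e e = e,
    e = 0 -> exists g, pmap_comp g f = pmap_id X &
    e = pmap_id X -> exists g, pmap_comp g (f - pmap_id X) = pmap_id X].
Proof.
have [e [eB ee e0 e1]] := fitting_mx hm (mx_of_pmap f) hens.
have [fD fP] := mx_of_pmap_comm f.
(* [D] and [parity] commute with the matrix of [f], hence with its bicommutant. *)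
have lift k : bicomm_mx (mx_of_pmap f) k -> exists g, mx_of_pmap g = k.
  by move=> kB; apply: pmap_of_mx; apply: kB.
have [e' ee'] := lift e eB; subst e; exists e'; split.
- by apply: mx_of_pmap_inj; rewrite mx_of_pmap_comp.
- move=> e'0; have [|N /lift[g <-] gf] := e0; first by rewrite e'0 mx_of_pmap0.
  exists g; apply: mx_of_pmap_inj; rewrite mx_of_pmap_comp mx_of_pmap_id.
  exact: mulmx1C.
- move=> e'1; have [|N /lift[g <-] gf] := e1; first by rewrite e'1
  mx_of_pmap_id.
  exists g; apply: mx_of_pmap_inj.
  by rewrite mx_of_pmap_comp mx_of_pmapB mx_of_pmap_id; apply: mulmx1C.
Qed.

(** The Fitting idempotent of a chain map representing [x] is 0 or the identity; accordingly [x] or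
    [1 - x] is left invertible. *)
Lemma local_endo : kclass (pmap_id X) <> 0 ->
  (forall e : periodic_map X X, pmap_comp e e = e -> e = 0 \/ e = pmap_id X) ->
  local_ring (endo (X : K2proj A)).
Proof.
move=> X0 idem; apply: local_ring_criterion; first exact: X0.
move=> x; have [e [/idem[e0|e1] H0 H1]] := fitting_pmap (repr (x : khom X X)).
  left; have [g gf] := H0 e0; exists (kclass g).
  by rewrite -[x]kclass_repr; apply: etrans (kcompE _ _) _; rewrite gf.
right; have [g gf] := H1 e1; exists (- kclass g).
rewrite mulNr -mulrN opprB -[x]kclass_repr.
rewrite -[1]/(kclass (pmap_id X)) -linearB.
by apply: etrans (kcompE _ _) _; rewrite gf.
Qed.

End Fitting.

(** * Finite direct sums in a linear category *)

Section LinearCategory.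
Variables (A : comNzRingType) (C : linear_category A).
Implicit Types X Y Z : C.

Lemma mcompDl X Y Z (f : mor X Y) (g g' : mor Y Z) :
  mcomp (g + g') f = mcomp g f + mcomp g' f.
Proof. by have := mcomp_linearl f 1 g g'; rewrite !scale1r. Qed.

Lemma mcompDr X Y Z (g : mor Y Z) (f f' : mor X Y) :
  mcomp g (f + f') = mcomp g f + mcomp g f'.
Proof. by have := mcomp_linearr g 1 f f'; rewrite !scale1r. Qed.

Lemma mcomp0l X Y Z (f : mor X Y) : mcomp (0 : mor Y Z) f = 0.
Proof. by apply: (addrI (mcomp 0 f)); rewrite -mcompDl !addr0. Qed.

Lemma mcomp0r X Y Z (g : mor Y Z) : mcomp g (0 : mor X Y) = 0.
Proof. by apply: (addrI (mcomp g 0)); rewrite -mcompDr !addr0. Qed.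

Lemma mcomp_sumr X Y Z (g : mor Y Z) n (F : 'I_n -> mor X Y) :
  mcomp g (\sum_i F i) = \sum_i mcomp g (F i).
Proof. exact: (big_morph _ (mcompDr g) (mcomp0r _ g)). Qed.

Lemma mcomp_suml X Y Z (f : mor X Y) n (F : 'I_n -> mor Y Z) :
  mcomp (\sum_i F i) f = \sum_i mcomp (F i) f.
Proof. exact: (big_morph (fun g => mcomp g f) (mcompDl f) (mcomp0l _ f)). Qed.

Lemma is_direct_sum0 X (Y : 'I_0 -> C) : mid X = 0 -> is_direct_sum X Y.
Proof.
by move=> X0; exists (fun=> 0), (fun=> 0); split=> [[]|[]|] //; rewrite
  big_ord0.
Qed.

Lemma is_direct_sum1 X : is_direct_sum X (fun _ : 'I_1 => X).
Proof.
exists (fun=> mid X), (fun=> mid X).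
by split=> [_|i j|]; rewrite ?big_ord1 ?mcomp1m // !ord1.
Qed.

Definition sum_family n1 n2 (Y1 : 'I_n1 -> C) (Y2 : 'I_n2 -> C) s :=
  match s with inl i => Y1 i | inr i => Y2 i end.

Lemma is_direct_sum_cat X X1 X2 (i1 : mor X1 X) (p1 : mor X X1)
    (i2 : mor X2 X) (p2 : mor X X2) n1 n2 (Y1 : 'I_n1 -> C) (Y2 : 'I_n2 -> C) :
  mcomp p1 i1 = mid X1 -> mcomp p2 i2 = mid X2 ->
  mcomp i1 p1 + mcomp i2 p2 = mid X ->
  is_direct_sum X1 Y1 -> is_direct_sum X2 Y2 ->
  is_direct_sum X (fun i : 'I_(n1 + n2) => sum_family Y1 Y2 (split i)).
Proof.
move=> p1i1 p2i2 ip [j1 [q1 [q1j1 q1j10 jq1]]] [j2 [q2 [q2j2 q2j20 jq2]]].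
(* Inserting [mid X = i1 p1 + i2 p2] between [p1] and [i2] gives [p1 i2 = p1 i2 + p1 i2]. *)
have p1i2 : mcomp p1 i2 = 0.
  apply: (addrI (mcomp p1 i2)); rewrite addr0 -[X in _ + X]mcompm1 -p2i2
    !mcompA.
  rewrite -[X in X + _]mcomp1m -p1i1 -!mcompA -mcompDr.
  by rewrite !mcompA -mcompDl ip mcomp1m.
have p2i1 : mcomp p2 i1 = 0.
  apply: (addrI (mcomp p2 i1)); rewrite addr0 -[X in X + _]mcompm1 -p1i1
    !mcompA.
  rewrite -[X in _ + X]mcomp1m -p2i2 -!mcompA -mcompDr.
  by rewrite !mcompA -mcompDl ip mcomp1m.
(* Indexing by the sum type lets these dependent types reduce by cases on [split i]. *)
pose j s : mor (sum_family Y1 Y2 s) X :=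
  match s with inl i => mcomp i1 (j1 i) | inr i => mcomp i2 (j2 i) end.
pose q s : mor X (sum_family Y1 Y2 s) :=
  match s with inl i => mcomp (q1 i) p1 | inr i => mcomp (q2 i) p2 end.
have qpij X3 X4 X5 X6 (g : mor X4 X3) (p : mor X X4) (i : mor X5 X)
  (f : mor X6 X5) :
  mcomp (mcomp g p) (mcomp i f) = mcomp g (mcomp (mcomp p i) f).
  by rewrite !mcompA.
exists (fun i => j (split i)), (fun i => q (split i)); split.
- move=> i; case: (split i) => k /=; rewrite qpij ?p1i1 ?p2i2 mcomp1m;
  [exact: q1j1|exact: q2j2].
- move=> a b; rewrite -(inj_eq (can_inj splitK)).
  case: (split a) (split b) => [k|k] [l|l] /= kl; rewrite qpij.
  + by rewrite p1i1 mcomp1m q1j10 //; apply: contraNneq kl => ->.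
  + by rewrite p1i2 mcomp0l mcomp0r.
  + by rewrite p2i1 mcomp0l mcomp0r.
  + by rewrite p2i2 mcomp1m q2j20 //; apply: contraNneq kl => ->.
- pose G s := mcomp (j s) (q s); rewrite (eq_bigr (fun i => G (split i))) //.
  rewrite big_split_ord /=.
  under eq_bigr do rewrite (unsplitK (inl _)).
  under [X in _ + X]eq_bigr do rewrite (unsplitK (inr _)).
  rewrite /G /= -[RHS]ip -[i1 in RHS]mcompm1 -[i2 in RHS]mcompm1 -jq1 -jq2.
  rewrite !mcomp_sumr !mcomp_suml; congr (_ + _);
  by apply: eq_bigr => k _; rewrite !mcompA.
Qed.

End LinearCategory.

(** * Splitting, adding and decomposing periodic complexes *)

Section PeriodicComplexes.
Variable A : comNzRingType.
Implicit Types X Y : periodic_complex A.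

(** This measure is not a homotopy invariant; it drops when a nontrivial idempotent chain map
    splits. *)
Definition rank X := (dim (ev X) + dim (od X))%N.

(** Each degree is split and the differentials are compressed to the summand; since they commute
    with [e], inclusion and projection are chain maps. *)
Lemma split_idempotent_pmap (m : set A) X (e : periodic_map X X) :
  local_ring_with m -> pmap_comp e e = e ->
  exists Y (i : periodic_map Y X) (p : periodic_map X Y),
    [/\ pmap_comp p i = pmap_id Y, pmap_comp i p = e
      & e <> pmap_id X -> (rank Y < rank X)%N].
Proof.
move=> hm ee; have /andP[/eqP e1 /eqP e2] := pmapP e.
have [ff gg] : (fev e \o fev e)%VF = fev e /\ (fod e \o fod e)%VF = fod e.
  by split; [move/(congr1 (@fev _ X X)): ee | move/(congr1 (@fod _ X X)): ee].
have e_val : pmap_val e = (fev e, fod e) by rewrite -surjective_pairing.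
move: (fev e) (fod e) e_val ff gg e1 e2 => f g e_val ff gg.
rewrite e_val /= => fd gd.
have [V [i1 [p1 [leV pi1 ip1 ltV]]]] := split_idempotent_lfun hm ff.
have [W [i2 [p2 [leW pi2 ip2 ltW]]]] := split_idempotent_lfun hm gg.
have pf : (p1 \o f)%VF = p1 by rewrite -ip1 comp_lfunA pi1 comp_lfun1l.
have pg : (p2 \o g)%VF = p2 by rewrite -ip2 comp_lfunA pi2 comp_lfun1l.
have fi : (f \o i1)%VF = i1 by rewrite -ip1 -comp_lfunA pi1 comp_lfun1r.
have gi : (g \o i2)%VF = i2 by rewrite -ip2 -comp_lfunA pi2 comp_lfun1r.
pose d := (p2 \o dev X \o i1)%VF; pose d' := (p1 \o dod X \o i2)%VF.
have i2d : (i2 \o d = dev X \o i1)%VF.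
  by rewrite /d !comp_lfunA ip2 -fd -comp_lfunA fi.
have i1d' : (i1 \o d' = dod X \o i2)%VF.
  by rewrite /d' !comp_lfunA ip1 -gd -comp_lfunA gi.
have dp1 : (d \o p1 = p2 \o dev X)%VF.
  by rewrite /d -!comp_lfunA ip1 fd comp_lfunA pg.
have d'p2 : (d' \o p2 = p1 \o dod X)%VF.
  by rewrite /d' -!comp_lfunA ip2 gd comp_lfunA pf.
have d'd : (d' \o d)%VF = 0.
  by rewrite {1}/d' -comp_lfunA i2d !comp_lfunA -(comp_lfunA p1) dod_dev
    comp_lfun0r comp_lfun0l.
have dd' : (d \o d')%VF = 0.
  by rewrite {1}/d -comp_lfunA i1d' !comp_lfunA -(comp_lfunA p2) dev_dod
    comp_lfun0r comp_lfun0l.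
have iP : @chain_map A (PeriodicComplex d'd dd') X (i1, i2).
  by rewrite /chain_map /= i2d i1d' !eqxx.
have pP : @chain_map A X (PeriodicComplex d'd dd') (p1, p2).
  by rewrite /chain_map /= dp1 d'p2 !eqxx.
exists (PeriodicComplex d'd dd'), (PeriodicMap iP), (PeriodicMap pP); split.
- by apply: val_inj; rewrite /= /fev /fod /= pi1 pi2.
- by apply: val_inj; rewrite /= /fev /fod /= ip1 ip2 e_val.
(* Some component of [e] is not the identity: the rank drops in that degree and does not grow in the
   other. *)
rewrite /rank /= => fg1; have [f1|/ltV lt] := pselect (f = \1%VF); last by
  rewrite -addSn leq_add.
have [g1|/ltW lt] := pselect (g = \1%VF); last by rewrite -addnS leq_add.
by case: fg1; apply: val_inj; rewrite /= e_val f1 g1.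
Qed.

Lemma lfun_biproduct (V1 V2 : vectType A) : exists (V : vectType A)
    (i1 : 'Hom(V1, V)) (i2 : 'Hom(V2, V)) (p1 : 'Hom(V, V1)) (p2 : 'Hom(V, V2)),
  [/\ (p1 \o i1)%VF = \1%VF, (p2 \o i2)%VF = \1%VF, (p1 \o i2)%VF = 0,
      (p2 \o i1)%VF = 0 & (i1 \o p1)%VF + (i2 \o p2)%VF = \1%VF].
Proof.
pose n1 := dim V1; pose n2 := dim V2.
pose I1 : 'M[A]_(n1, n1 + n2) := row_mx 1%:M 0.
pose I2 : 'M[A]_(n2, n1 + n2) := row_mx 0 1%:M.
pose P1 : 'M[A]_(n1 + n2, n1) := col_mx 1%:M 0.
pose P2 : 'M[A]_(n1 + n2, n2) := col_mx 0 1%:M.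
exists 'rV[A]_(n1 + n2), (linfun (mulmxr I1 \o v2r)),
  (linfun (mulmxr I2 \o v2r)),
  (linfun (@r2v A V1 \o mulmxr P1)),
  (linfun (@r2v A V2 \o mulmxr P2)).
split; apply/lfunP=> u; rewrite ?add_lfunE !comp_lfunE !lfunE /= ?r2vK -!mulmxA.
- by rewrite mul_row_col mulmx1 mulmx0 addr0 mulmx1 v2rK.
- by rewrite mul_row_col mulmx1 mulmx0 add0r mulmx1 v2rK.
- by rewrite mul_row_col mul0mx mulmx0 addr0 mulmx0 linear0.
- by rewrite mul_row_col mul0mx mulmx0 addr0 mulmx0 linear0.
rewrite -mulmxDr !mul_col_row !(mulmx0, mul0mx, mulmx1) add_block_mx.
by rewrite !addr0 !add0r -scalar_mx_block mulmx1.
Qed.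

Lemma exists_zero_complex : exists X, kclass (pmap_id X) = 0.
Proof.
pose z : 'End('rV[A]_0) := 0.
have dd : (z \o z)%VF = 0 by apply: comp_lfun0l.
have idz : \1%VF = z by apply/lfunP=> u; apply/rowP; case.
exists (PeriodicComplex dd dd); rewrite (_ : pmap_id _ = 0) ?linear0 //.
by apply: val_inj; rewrite /= idz.
Qed.

(** With the diagonal differential, the biproduct identities hold already for chain maps. *)
Lemma exists_biproduct (X1 X2 : K2proj A) :
  exists (X : K2proj A) (i1 : mor X1 X) (p1 : mor X X1) (i2 : mor X2 X)
    (p2 : mor X X2), [/\ mcomp p1 i1 = mid X1, mcomp p2 i2 = mid X2
      & mcomp i1 p1 + mcomp i2 p2 = mid X].
Proof.
have [V [i1 [i2 [p1 [p2 [pi11 pi22 pi12 pi21 ipV]]]]]] := lfun_biproduct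
  (ev X1) (ev X2).
have [W [j1 [j2 [q1 [q2 [qj11 qj22 qj12 qj21 jqW]]]]]] := lfun_biproduct
  (od X1) (od X2).
pose d := ((j1 \o dev X1 \o p1) + (j2 \o dev X2 \o p2))%VF.
pose d' := ((i1 \o dod X1 \o q1) + (i2 \o dod X2 \o q2))%VF.
have di1 : (d \o i1 = j1 \o dev X1)%VF.
  by rewrite comp_lfunDl -!comp_lfunA pi11 pi21 !comp_lfun0r comp_lfun1r addr0.
have di2 : (d \o i2 = j2 \o dev X2)%VF.
  by rewrite comp_lfunDl -!comp_lfunA pi12 pi22 !comp_lfun0r comp_lfun1r add0r.
have d'j1 : (d' \o j1 = i1 \o dod X1)%VF.
  by rewrite comp_lfunDl -!comp_lfunA qj11 qj21 !comp_lfun0r comp_lfun1r addr0.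
have d'j2 : (d' \o j2 = i2 \o dod X2)%VF.
  by rewrite comp_lfunDl -!comp_lfunA qj12 qj22 !comp_lfun0r comp_lfun1r add0r.
have q1d : (q1 \o d = dev X1 \o p1)%VF.
  by rewrite comp_lfunDr !comp_lfunA qj11 qj12 !comp_lfun0l comp_lfun1l addr0.
have q2d : (q2 \o d = dev X2 \o p2)%VF.
  by rewrite comp_lfunDr !comp_lfunA qj21 qj22 !comp_lfun0l comp_lfun1l add0r.
have p1d' : (p1 \o d' = dod X1 \o q1)%VF.
  by rewrite comp_lfunDr !comp_lfunA pi11 pi12 !comp_lfun0l comp_lfun1l addr0.
have p2d' : (p2 \o d' = dod X2 \o q2)%VF.
  by rewrite comp_lfunDr !comp_lfunA pi21 pi22 !comp_lfun0l comp_lfun1l add0r.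
have d'd : (d' \o d)%VF = 0.
  rewrite /d comp_lfunDr !comp_lfunA d'j1 d'j2 -(comp_lfunA _ (dod X1))
    -(comp_lfunA _ (dod X2)) !dod_dev.
  by rewrite !(comp_lfun0l, comp_lfun0r) addr0.
have dd' : (d \o d')%VF = 0.
  rewrite /d' comp_lfunDr !comp_lfunA di1 di2 -(comp_lfunA _ (dev X1))
    -(comp_lfunA _ (dev X2)) !dev_dod.
  by rewrite !(comp_lfun0l, comp_lfun0r) addr0.
pose X := PeriodicComplex d'd dd'.
have i1P : @chain_map A X1 X (i1, j1) by rewrite /chain_map /= di1 d'j1 !eqxx.
have i2P : @chain_map A X2 X (i2, j2) by rewrite /chain_map /= di2 d'j2 !eqxx.
have p1P : @chain_map A X X1 (p1, q1) by rewrite /chain_map /= q1d p1d' !eqxx.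
have p2P : @chain_map A X X2 (p2, q2) by rewrite /chain_map /= q2d p2d' !eqxx.
exists X, (kclass (PeriodicMap i1P)), (kclass (PeriodicMap p1P)),
  (kclass (PeriodicMap i2P)), (kclass (PeriodicMap p2P)); rewrite /= !kcompE.
split; first by congr kclass; apply: val_inj; rewrite /= /fev /fod /= pi11 qj11.
  by congr kclass; apply: val_inj; rewrite /= /fev /fod /= pi22 qj22.
rewrite -kclassD; congr kclass; apply: val_inj.
by rewrite /= /fev /fod /= /pmap_id -ipV -jqW.
Qed.

Lemma K2proj_additive : additive_category (K2proj A).
Proof.
elim=> [|n IHn] Y.
  by have [X X0] := exists_zero_complex; exists X; apply: is_direct_sum0.
pose Y1 (i : 'I_1) := Y (lshift n i : 'I_(1 + n)).
pose Y2 (i : 'I_n) := Y (rshift 1 i : 'I_(1 + n)).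
have [X2 XY2] := IHn Y2.
have [X [i1 [p1 [i2 [p2 [pi1 pi2 ip]]]]]] := exists_biproduct (Y1 ord0) X2.
have XY1 : is_direct_sum (Y1 ord0) Y1.
  have -> : Y1 = fun=> Y1 ord0 by apply/funext => i; rewrite ord1.
  exact: is_direct_sum1.
exists X; have := is_direct_sum_cat pi1 pi2 ip XY1 XY2.
congr is_direct_sum; apply/funext => i.
by rewrite -[i in RHS](splitK (i : 'I_(1 + n))); case: split.
Qed.

(** Induction on [rank]: a contractible complex is the empty sum, one without nontrivial idempotent
    chain maps is local, and any other splits. *)
Lemma K2proj_decomposition (m : set A) (X : K2proj A) :
  local_ring_with m -> henselian m ->
  exists (n : nat) (Y : 'I_n -> K2proj A),
    is_direct_sum X Y /\ forall i, local_ring (endo (Y i)).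
Proof.
move=> hm hens; have [n] := ubnP (rank X); elim: n X => // n IHn X ltXn.
have [X0|X0] := pselect (kclass (pmap_id X) = 0).
  by exists 0, (fun=> X); split=> [|[]//]; apply: is_direct_sum0.
have [idem|] := pselect (forall e : periodic_map X X,
    pmap_comp e e = e -> e = 0 \/ e = pmap_id X).
  exists 1, (fun=> X); split=> [|_]; first exact: is_direct_sum1.
  exact: local_endo hm hens X0 idem.
move=> /existsNP[e /not_implyP[ee /not_orP[e0 e1]]].
pose e' := pmap_id X - e.
have ee' : pmap_comp e' e' = e'.
  (* By linearity [e e' = e - e e = 0], whence [e' e' = e' - e e' = e']. *)
  have := pmap_comp_linearl e' (-1) e (pmap_id X).
  have := pmap_comp_linearr e (-1) e (pmap_id X).
  rewrite !scaleN1r [- e + _]addrC -/e' pmap_comp1m pmap_compm1 ee addNr => ->.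
  by rewrite oppr0 add0r.
have e'1 : e' <> pmap_id X.
  by move=> /(congr1 (fun k => pmap_id X - k)); rewrite subKr subrr.
(* Neither [e] nor [e'] is the identity, so both summands have smaller rank. *)
have [X1 [i1 [p1 [pi1 ip1 /(_ e1) lt1]]]] := split_idempotent_pmap hm ee.
have [X2 [i2 [p2 [pi2 ip2 /(_ e'1) lt2]]]] := split_idempotent_pmap hm ee'.
have [n1 [Y1 [XY1 loc1]]] := IHn X1 (leq_trans lt1 ltXn).
have [n2 [Y2 [XY2 loc2]]] := IHn X2 (leq_trans lt2 ltXn).
exists (n1 + n2)%N, (fun i => sum_family Y1 Y2 (split i)); split; last first.
  by move=> i; case: (split i).
apply: (@is_direct_sum_cat _ _ X X1 X2 (kclass i1) (kclass p1) (kclass i2)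
  (kclass p2)) XY1 XY2; rewrite /= !kcompE ?pi1 ?pi2 //.
by rewrite -kclassD ip1 ip2 addrC subrK.
Qed.

End PeriodicComplexes.

Theorem theorem1p3 (A : comNzRingType) (m : set A)
  (hlocal : local_ring_with m) (hnoeth : noetherian A)
  (hhens : henselian m) :
  krull_schmidt (K2proj A).
Proof.
by split=> [|X]; [apply: K2proj_additive | apply: K2proj_decomposition hhens].
Qed.
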